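(* Let $N\ge 2$, $d\ge 1$ be integers and $\tau>0$. Consider the system with transmission-type delay $$\dot x_i(t)=\sum_{j\neq i}\psi_{ij}(t)\,\bigl(x_j(t-\tau)-x_i(t)\bigr),\qquad i\in[N],\ t>0,$$ with initial datum $x_i(t)=x_i^0(t)$ for $t\in[-\tau,0]$, where $x_i^0:[-\tau,0]\to\mathbb{R}^d$ are prescribed continuous functions. Assume that the communication weights satisfy $$\sum_{j\neq i}\psi_{ij}(t)\le 1\qquad\text{for all } t\ge 0 \text{ and } i\in[N],$$ and the global positivity property: for every $R>0$ there exists $\underline\psi=\underline\psi(R)>0$ such that for every $T>0$, if $|x_i(t)-x_j(t)|\le R$ for all $t\in[-\tau,T]$ and all $i,j\in[N]$, then $\psi_{ij}(t)\ge \frac{\underline\psi}{N-1}$ for all $t\in[0,T]$ and all $i\ne j$ in $[N]$. Then every solution reaches global asymptotic consensus, i.e. $$\lim_{t\to\infty} d_x(t)=0,\qquad d_x(t):=\max_{i,j\in[N]}|x_i(t)-x_j(t)|.$$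
   Context: $[N]:=\{1,\dots,N\}$ and $|\cdot|$ is the Euclidean norm. A solution consists of continuous functions $x_i:[-\tau,\infty)\to\mathbb{R}^d$, continuously differentiable on $[0,\infty)$, satisfying the system and the initial condition. The communication weights $\psi_{ij}=\psi_{ij}(t)\ge 0$ ($i\neq j$) may depend on the history of the trajectories; no particular expression is fixed, and the hypotheses are imposed on the resulting functions of time along the solution considered. Standing assumption: all $\psi_{ij}$ are continuous functions of time $t\ge 0$. *)

(* Defs.v *)
From mathcomp Require Export all_boot all_order all_algebra.
From mathcomp Require Export all_classical all_reals all_analysis.
Export Order.TTheory GRing.Theory Num.Theory.
Export numFieldNormedType.Exports.

Set Implicit Arguments.
Unset Strict Implicit.
Unset Printing Implicit Defensive.

Local Open Scope classical_set_scope.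
Local Open Scope ring_scope.

(* The library norm on matrices is the sup norm, hence this definition. *)
Definition euclidean_norm (R : realType) (d : nat) (v : 'rV[R]_d) : R :=
  Num.sqrt (\sum_(k < d) v ord0 k ^+ 2).

(* The neutral element 0 is harmless, all the distances being nonnegative. *)
Definition diameter (R : realType) (N d : nat) (x : 'I_N -> R -> 'rV[R]_d)
    (t : R) : R :=
  \big[Num.max/0]_(i < N) \big[Num.max/0]_(j < N)
    euclidean_norm (x i t - x j t).

(* Difference quotients are taken inside D, so that at an endpoint of an
   interval D the derivative is one-sided and f is not constrained outside D. *)
Definition continuously_differentiable_on (R : realType) (d : nat) (D : set R)
    (f : R -> 'rV[R]_d) : Prop :=
  exists2 g : R -> 'rV[R]_d, {within D, continuous g} &
    forall t, D t ->
      (s - t)^-1 *: (f s - f t) @[s --> within D t^'] --> g t.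

(* Functions on [-tau, oo) and on [0, oo) are encoded as total functions on R
   of which only the values on these intervals matter; likewise the diagonal
   weights psi i i are never used. *)
Definition is_solution (R : realType) (N d : nat) (tau : R)
    (psi : 'I_N -> 'I_N -> R -> R) (x0 x : 'I_N -> R -> 'rV[R]_d) : Prop :=
  forall i : 'I_N,
    [/\ {within `[- tau, +oo[, continuous (x i)},
        continuously_differentiable_on `[0, +oo[ (x i),
        forall t : R, 0 < t ->
          is_derive t 1 (x i)
            (\sum_(j < N | j != i) psi i j t *: (x j (t - tau) - x i t)) &
        forall t : R, - tau <= t <= 0 -> x i t = x0 i t].

Definition global_positivity (R : realType) (N d : nat) (tau : R)
    (psi : 'I_N -> 'I_N -> R -> R) (x : 'I_N -> R -> 'rV[R]_d) : Prop :=
  forall r : R, 0 < r ->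
    exists2 c : R, 0 < c &
      forall T : R, 0 < T ->
        (forall (t : R) (i j : 'I_N), - tau <= t <= T ->
          euclidean_norm (x i t - x j t) <= r) ->
        forall (t : R) (i j : 'I_N), 0 <= t <= T -> i != j ->
          c / (N.-1)%:R <= psi i j t.

(* Main.v *)
Require Import Defs.
From mathcomp Require Import ring lra.

(** The system acts on each coordinate separately, through the same weights, so
    everything reduces to real-valued [y i].

    The right-hand side pulls [y i t] towards the delayed values [y j (t - tau)],
    so an interval [[m, M]] containing the histories over a window of length [tau]
    contains the solution forever ([in_band_forward]).  In particular all mutual
    distances stay below some [r], and the global positivity property at radius
    [r] yields one [c > 0] bounding all weights from below at all times
    ([weights_uniformly_positive]).

    With such a [c] the interval shrinks geometrically.  Any member, say [i0], is at
    time [t0] at distance at least [(M - m) / 2] from one end, say [M].  Since the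
    weights sum to at most [1], the gap [M - y i0] decays at most like
    [expR (- t)]; with a delay [tau] it acts on every other member as a source of
    strength at least [c] times its size, so after [2 * tau] all gaps
    are at least a fixed fraction of [M - m], and they do so during a whole window of
    length [tau] ([positivity_spreads]).  Hence the width of the interval is
    multiplied by a constant [q < 1] every [3 * tau] ([band_contracts]) and tends
    to zero ([scalar_consensus]). *)

Set Implicit Arguments.
Unset Strict Implicit.
Unset Printing Implicit Defensive.

Local Open Scope classical_set_scope.
Local Open Scope ring_scope.

(** * One-dimensional comparison principles *)

Lemma ge0_derive_le (R : realType) (f df : R -> R) (a b : R) :
  a <= b -> {within `[a, b], continuous f} ->
  (forall t, a < t < b -> is_derive t 1 f (df t)) ->
  (forall t, a < t < b -> 0 <= df t) ->
  f a <= f b.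
Proof.
rewrite le_eqVlt => /predU1P[-> //|ab] cf fE df0.
have fE' t : t \in `]a, b[ -> is_derive t 1 f (df t) by rewrite in_itv /=; exact: fE.
have [c cab fba] := MVT ab fE' cf.
rewrite -subr_ge0 fba mulr_ge0 ?subr_ge0 ?(ltW ab)//.
by apply: df0; move: cab; rewrite in_itv.
Qed.

(** The sign of the derivative is only known where [f] is negative.  If [f]
    ended negative, it would be negative from its last nonnegative instant [s]
    on, hence nondecreasing there, which contradicts [f b < 0 <= f s]. *)
Lemma nonneg_barrier (R : realType) (f df : R -> R) (a b : R) :
  a <= b -> {within `[a, b], continuous f} ->
  (forall t, a < t < b -> is_derive t 1 f (df t)) ->
  (forall t, a < t < b -> f t < 0 -> 0 <= df t) ->
  0 <= f a -> 0 <= f b.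
Proof.
move=> ab cf fE df0 fa0; rewrite leNgt; apply/negP => fb0.
pose S := [set t | a <= t <= b /\ 0 <= f t].
have Sa : S a by rewrite /S /= lexx ab.
have supS : has_sup S by split; [exists a | exists b => t [/andP[]]].
pose s := sup S.
have as_ : a <= s by exact: sup_upper_bound.
have sb : s <= b by apply: ge_sup; [exists a | move=> t [/andP[]]].
have fgts t : s < t -> t <= b -> f t < 0.
  move=> st tb; rewrite ltNge; apply/negP => ft.
  have : t <= s by apply: sup_upper_bound => //; rewrite /S /= tb (le_trans as_ (ltW st)).
  by rewrite leNgt st.
have fs0 : 0 <= f s.
  rewrite leNgt; apply/negP => fs0.
  have as' : a < s.
    by rewrite lt_neqAle as_ andbT; apply: contraTneq fs0 => <-; rewrite -leNgt.
  (* If [f s < 0], left continuity makes [f] negative just before [s], against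
     the definition of [s] as a supremum. *)
  have cfs : {within `[a, s], continuous f}.
    by apply: continuous_subspaceW cf; apply: subset_itvl; rewrite bnd_simp.
  have [_ _ fls] := (continuous_within_itvP _ as').1 cfs.
  have : \forall t \near s^'-, f t < 0 by exact: cvgr_lt fls _ fs0.
  move=> [e /= e0 se].
  have [t [/andP[at_ tb] ft] st] := sup_adherent e0 supS.
  have ts : t <= s by apply: sup_upper_bound => //; rewrite /S /= at_ tb.
  have ts' : t < s.
    by rewrite lt_neqAle ts andbT; apply: contraTneq ft => ->; rewrite -ltNge.
  suff : f t < 0 by rewrite ltNge ft.
  by apply: se => //=; rewrite ger0_norm ?subr_ge0//; rewrite ltrBlDr addrC -ltrBlDr.
suff : f s <= f b by rewrite leNgt (lt_le_trans fb0 fs0).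
apply: (@ge0_derive_le _ f df) => //.
- by apply: continuous_subspaceW cf; apply: subset_itvr; rewrite bnd_simp.
- by move=> t /andP[st tb]; apply: fE; rewrite tb (le_lt_trans as_ st).
- move=> t /andP[st tb]; apply: df0; first by rewrite tb (le_lt_trans as_ st).
  by apply: fgts => //; exact: ltW.
Qed.

(** Variation of constants: the right-hand side of the conclusion is the value at
    [b] of the solution of [h' = g - h] with [h a = f a].  The proof is that
    [expR t * (f t - g)] is nondecreasing. *)
Lemma relaxation_lower_bound (R : realType) (f df : R -> R) (a b g : R) :
  a <= b -> {within `[a, b], continuous f} ->
  (forall t, a < t < b -> is_derive t 1 f (df t)) ->
  (forall t, a < t < b -> g - f t <= df t) ->
  g + expR (a - b) * (f a - g) <= f b.
Proof.
move=> ab cf fE dfg.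
pose h (t : R) := expR t * (f t - g).
have : h a <= h b.
  apply: (@ge0_derive_le _ h (fun t => expR t * (f t - g + df t))) => //.
  - move=> t; apply: continuousM.
      by apply: continuous_subspaceT => ?; exact: continuous_expR.
    by apply: continuousB; [exact: cf|exact: cvg_cst].
  - move=> t /fE ft.
    have dh : is_derive t 1 h (expR t *: (df t - 0) + (f t - g) *: expR t).
      exact: (is_deriveM (is_derive_expR t) (is_deriveB ft (is_derive_cst g t 1))).
    by apply: is_derive_eq dh _; rewrite subr0 /GRing.scale /=; ring.
  - by move=> t /dfg tg; apply: mulr_ge0; [exact: expR_ge0 | lra].
rewrite /h => hab.
have eb := expR_gt0 b.
rewrite -(ler_pM2l eb) mulrDr mulrA -expRD subrKC.
by move: hab; rewrite !mulrBr; lra.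
Qed.

(** * The scalar delayed system *)

Definition admissible_weights (R : realType) (N : nat)
    (psi : 'I_N -> 'I_N -> R -> R) : Prop :=
  (forall i j t, i != j -> 0 <= t -> 0 <= psi i j t) /\
  (forall i t, 0 <= t -> \sum_(j < N | j != i) psi i j t <= 1).

Definition scalar_solution (R : realType) (N : nat) (tau : R)
    (psi : 'I_N -> 'I_N -> R -> R) (y : 'I_N -> R -> R) : Prop :=
  (forall i, {within `[- tau, +oo[, continuous (y i)}) /\
  (forall i (t : R), 0 < t -> is_derive t 1 (y i)
     (\sum_(j < N | j != i) psi i j t * (y j (t - tau) - y i t))).

(** The delay makes the history over [[t0 - tau, t0]], and not only the value at
    [t0], the state of the system at time [t0]. *)
Definition in_band (R : realType) (N : nat) (tau : R) (y : 'I_N -> R -> R)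
    (t0 m M : R) : Prop :=
  forall i s, t0 - tau <= s <= t0 -> m <= y i s <= M.

(** The right-hand side only involves differences.  With [a = -1, b = M] and
    [a = 1, b = - m], this turns upper and lower bounds on [y] into the
    nonnegativity of a solution, so that only nonnegative solutions need to be
    studied. *)
Lemma scalar_solution_affine (R : realType) (N : nat) (tau : R)
    (psi : 'I_N -> 'I_N -> R -> R) (y : 'I_N -> R -> R) (a b : R) :
  scalar_solution tau psi y ->
  scalar_solution tau psi (fun i t => a * y i t + b).
Proof.
move=> [cy dy]; split=> [i|i t t0].
  move=> t; pose ay (s : subspace `[- tau, +oo[) := a * y i s.
  apply: (@continuousD _ _ _ ay (cst b)); last exact: cvg_cst.
  by apply: continuousM; [exact: cvg_cst|exact: cy].
have dz : is_derive t 1 (a \*: y i + cst b)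
    (a *: (\sum_(j < N | j != i) psi i j t * (y j (t - tau) - y i t)) + 0).
  exact: (is_deriveD (is_deriveZ a (dy i t t0)) (is_derive_cst b t 1)).
apply: is_derive_eq dz _.
rewrite addr0 /GRing.scale /= mulr_sumr; apply: eq_bigr => j _; ring.
Qed.

Lemma scalar_solution_continuous (R : realType) (N : nat) (tau : R)
    (psi : 'I_N -> 'I_N -> R -> R) (y : 'I_N -> R -> R) (a b : R) :
  scalar_solution tau psi y -> - tau <= a ->
  forall i, {within `[a, b], continuous (y i)}.
Proof.
move=> [cy _] ta i; apply: continuous_subspaceW (cy i) => t /=.
by rewrite !in_itv /= andbT => /andP[/(le_trans ta)].
Qed.

(** Method of steps: on a time interval of length [tau] the delayed values are
    already known to be nonnegative, so a negative [y i] is pushed upwards and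
    the barrier argument applies. *)
Lemma scalar_solution_nonneg (R : realType) (N : nat) (tau : R)
    (psi : 'I_N -> 'I_N -> R -> R) (y : 'I_N -> R -> R) (t0 : R) :
  0 < tau -> admissible_weights psi -> scalar_solution tau psi y -> 0 <= t0 ->
  (forall i s, t0 - tau <= s <= t0 -> 0 <= y i s) ->
  forall i s, t0 - tau <= s -> 0 <= y i s.
Proof.
move=> tau0 [psi0 _] ysol t00 y0.
have step n : forall i s, t0 - tau <= s <= t0 + n%:R * tau -> 0 <= y i s.
  elim: n => [|n IH] i s; first by rewrite mul0r addr0; exact: y0.
  rewrite -natr1 mulrDl mul1r => /andP[s1 s2].
  have [st0|t0s] := leP s t0; first by apply: y0; rewrite s1 st0.
  pose dy t := \sum_(j < N | j != i) psi i j t * (y j (t - tau) - y i t).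
  apply: (@nonneg_barrier _ (y i) dy t0) => //; first exact: ltW.
  - by apply: (scalar_solution_continuous ysol); lra.
  - by move=> t /andP[t1 _]; apply: ysol.2; lra.
  - move=> t /andP[t1 t2] yt0; apply: sumr_ge0 => j ji.
    have t0' : 0 <= t by lra.
    have pij : 0 <= psi i j t by apply: psi0; rewrite // eq_sym.
    apply: mulr_ge0 => //; suff : 0 <= y j (t - tau) by lra.
    by apply: IH; apply/andP; split; lra.
  - by apply: y0; apply/andP; split; lra.
move=> i s s1; apply: (step (Num.bound `|(s - t0) / tau|)); rewrite s1 /=.
rewrite -lerBlDl -ler_pdivrMr//.
exact: le_trans (ler_norm _) (ltW (archi_boundP (normr_ge0 _))).
Qed.

(** Maximum principle: the convex hull of the history never grows. *)
Lemma in_band_forward (R : realType) (N : nat) (tau : R)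
    (psi : 'I_N -> 'I_N -> R -> R) (y : 'I_N -> R -> R) (t0 m M : R) :
  0 < tau -> admissible_weights psi -> scalar_solution tau psi y -> 0 <= t0 ->
  in_band tau y t0 m M ->
  forall i s, t0 - tau <= s -> m <= y i s <= M.
Proof.
move=> tau0 adm ysol t00 band i s s1; apply/andP; split.
- suff : 0 <= 1 * y i s + - m by lra.
  apply: (scalar_solution_nonneg tau0 adm (scalar_solution_affine 1 (- m) ysol) t00)=> //.
  by move=> j u /(band j u) /andP[h _]; lra.
- suff : 0 <= -1 * y i s + M by lra.
  apply: (scalar_solution_nonneg tau0 adm (scalar_solution_affine (-1) M ysol) t00)=> //.
  by move=> j u /(band j u) /andP[_ h]; lra.
Qed.

(** Over three delays a nonnegative component keeps at least the fraction
    [expR (- (3 * tau))] of its initial value; transmitted with weight at least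
    [c] and accumulated by relaxation during a time [tau], this gives the other
    factors. *)
Definition spreading_rate (R : realType) (tau c : R) : R :=
  c * expR (- (3 * tau)) * (1 - expR (- tau)).

Lemma spreading_rate_gt0 (R : realType) (tau c : R) :
  0 < tau -> 0 < c -> 0 < spreading_rate tau c.
Proof.
move=> tau0 c0; rewrite /spreading_rate !mulr_gt0 ?expR_gt0// subr_gt0.
by rewrite expR_lt1 oppr_lt0.
Qed.

Lemma spreading_rate_le (R : realType) (tau c : R) :
  0 < tau -> 0 < c <= 1 -> spreading_rate tau c <= expR (- (3 * tau)).
Proof.
move=> tau0 /andP[c0 c1]; rewrite /spreading_rate mulrAC -[leRHS]mul1r.
have e1 := expR_gt0 (- tau).
have e2 : expR (- tau) <= 1 by rewrite expR_le1 oppr_le0 ltW.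
apply: ler_wpM2r; first exact: expR_ge0.
by rewrite -[leRHS]mul1r ler_pM//; lra.
Qed.

(** The total weight being at most [1], no component decays faster than
    [expR (- t)]; hence [y i0] stays above a fixed fraction of [delta].  After
    one delay every other component feels this as a source of strength at least
    [g], and one further delay is enough to relax towards [g] by the factor
    [1 - expR (- tau)].  From [t0 + 2 * tau] to [t0 + 3 * tau] the lower bound
    thus holds over a whole history window, so the argument can be restarted. *)
Lemma positivity_spreads (R : realType) (N : nat) (tau c : R)
    (psi : 'I_N -> 'I_N -> R -> R) (y : 'I_N -> R -> R) (t0 delta : R)
    (i0 : 'I_N) :
  0 < tau -> admissible_weights psi -> 0 < c <= 1 ->
  (forall i j t, i != j -> 0 <= t -> c <= psi i j t) ->
  scalar_solution tau psi y -> 0 <= t0 ->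
  (forall i s, t0 - tau <= s <= t0 -> 0 <= y i s) ->
  0 <= delta <= y i0 t0 ->
  forall i t, t0 + 2 * tau <= t <= t0 + 3 * tau ->
  spreading_rate tau c * delta <= y i t.
Proof.
move=> tau0 adm c01 cpsi ysol t00 yband /andP[d0 yd] i t /andP[t1 t2].
have y0 := scalar_solution_nonneg tau0 adm ysol t00 yband.
have [psi0 psi1] := adm.
pose dy k s := \sum_(j < N | j != k) psi k j s * (y j (s - tau) - y k s).
(* The damping coefficient, which is at most [1], is replaced by [1]: this is
   where [y k s >= 0] matters. *)
have dyE k s : t0 < s ->
    \sum_(j < N | j != k) psi k j s * y j (s - tau) - y k s <= dy k s.
  move=> s0; rewrite /dy; under [leRHS]eq_bigr do rewrite mulrBr.
  rewrite big_split /= sumrN -mulr_suml lerD2l lerN2 ler_piMl//.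
    by apply: y0; lra.
  by apply: psi1; lra.
have terms_ge0 k s (j : 'I_N) : t0 < s -> j != k -> 0 <= psi k j s * y j (s - tau).
  move=> s0 jk; apply: mulr_ge0; first by apply: psi0; [rewrite eq_sym|lra].
  by apply: y0; lra.
have source s : t0 <= s <= t0 + 3 * tau -> expR (- (3 * tau)) * delta <= y i0 s.
  move=> /andP[s1 s2].
  have : 0 + expR (t0 - s) * (y i0 t0 - 0) <= y i0 s.
    apply: (@relaxation_lower_bound _ (y i0) (dy i0)) => //.
    - by apply: (scalar_solution_continuous ysol); lra.
    - by move=> u /andP[u1 _]; apply: ysol.2; lra.
    - move=> u /andP[u1 _]; apply: le_trans (dyE i0 u u1).
      by rewrite lerD2r sumr_ge0// => j; exact: terms_ge0.
  rewrite add0r subr0; apply: le_trans.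
  by rewrite ler_pM ?expR_ge0// ler_expR; lra.
have [->|ii0] := eqVneq i i0.
  apply: le_trans (source t _); last by apply/andP; split; lra.
  by apply: ler_wpM2r => //; exact: spreading_rate_le.
pose g := c * (expR (- (3 * tau)) * delta).
have g0 : 0 <= g by rewrite !mulr_ge0 ?expR_ge0//; case/andP: c01 => /ltW.
pose a := t0 + tau.
have : g + expR (a - t) * (y i a - g) <= y i t.
  apply: (@relaxation_lower_bound _ (y i) (dy i)) => //.
  - by rewrite /a; lra.
  - by apply: (scalar_solution_continuous ysol); rewrite /a; lra.
  - by move=> u /andP[u1 _]; apply: ysol.2; rewrite /a in u1; lra.
  - rewrite /a => u /andP[u1 u2].
    have u0 : t0 < u by lra.
    apply: le_trans (dyE i u u0); rewrite lerD2r.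
    rewrite (bigD1 i0) 1?eq_sym//= -[leLHS]addr0 lerD//; last first.
      by apply: sumr_ge0 => j /andP[ji _]; exact: terms_ge0.
    have [c0 _] := andP c01.
    apply: ler_pM; rewrite ?mulr_ge0 ?expR_ge0 ?(ltW c0)//.
      by apply: cpsi => //; lra.
    by apply: source; apply/andP; split; lra.
apply: le_trans.
have ya : 0 <= y i a by apply: y0; rewrite /a; lra.
have ea : expR (a - t) <= expR (- tau) by rewrite ler_expR /a; lra.
have -> : spreading_rate tau c * delta = g * (1 - expR (- tau)).
  by rewrite /spreading_rate /g; ring.
have e0 := expR_ge0 (a - t).
have : 0 <= expR (a - t) * y i a by exact: mulr_ge0.
have : expR (a - t) * g <= expR (- tau) * g by exact: ler_wpM2r.
by rewrite !mulrBr mulr1; lra.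
Qed.

(** Any given component lies, at time [t0], at distance at least [(M - m) / 2]
    from one of the two ends of the band; the spreading of positivity applied to the
    distances to that end moves it inwards. *)
Lemma band_contracts (R : realType) (N : nat) (tau c : R)
    (psi : 'I_N -> 'I_N -> R -> R) (y : 'I_N -> R -> R) (t0 m M : R)
    (i0 : 'I_N) :
  0 < tau -> admissible_weights psi -> 0 < c <= 1 ->
  (forall i j t, i != j -> 0 <= t -> c <= psi i j t) ->
  scalar_solution tau psi y -> 0 <= t0 -> in_band tau y t0 m M ->
  exists m' M', in_band tau y (t0 + 3 * tau) m' M' /\
    M' - m' = (1 - spreading_rate tau c / 2) * (M - m).
Proof.
move=> tau0 adm c01 cpsi ysol t00 band.
have fwd := in_band_forward tau0 adm ysol t00 band.
have /andP[my yM] : m <= y i0 t0 <= M by apply: fwd; lra.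
have [low|high] := leP (y i0 t0) ((m + M) / 2).
- exists m, (M - spreading_rate tau c * ((M - m) / 2)).
  split; last by field.
  move=> i s /andP[s1 s2].
  have /andP[ms _] : m <= y i s <= M by apply: fwd; lra.
  rewrite ms /=.
  suff : spreading_rate tau c * ((M - m) / 2) <= -1 * y i s + M by lra.
  apply: (positivity_spreads (i0 := i0) tau0 adm c01 cpsi
    (scalar_solution_affine (-1) M ysol) t00); [|lra..].
  by move=> j u /(band j u) /andP[_ h]; lra.
- exists (m + spreading_rate tau c * ((M - m) / 2)), M.
  split; last by field.
  move=> i s /andP[s1 s2].
  have /andP[_ ->] : m <= y i s <= M by apply: fwd; lra.
  rewrite andbT.
  suff : spreading_rate tau c * ((M - m) / 2) <= 1 * y i s + - m by lra.
  apply: (positivity_spreads (i0 := i0) tau0 adm c01 cpsi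
    (scalar_solution_affine 1 (- m) ysol) t00); [|lra..].
  by move=> j u /(band j u) /andP[h _]; lra.
Qed.

(** The width of the band is multiplied by [q < 1] every three delays, and the
    maximum principle controls the solution between these instants. *)
Lemma scalar_consensus (R : realType) (N : nat) (tau c : R)
    (psi : 'I_N -> 'I_N -> R -> R) (y : 'I_N -> R -> R) (m M : R)
    (i0 : 'I_N) :
  0 < tau -> admissible_weights psi -> 0 < c <= 1 ->
  (forall i j t, i != j -> 0 <= t -> c <= psi i j t) ->
  scalar_solution tau psi y -> in_band tau y 0 m M ->
  forall e, 0 < e -> \forall t \near +oo, forall i j, `|y i t - y j t| <= e.
Proof.
move=> tau0 adm c01 cpsi ysol band e e0.
pose q := 1 - spreading_rate tau c / 2.
have [c0 c1] := andP c01.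
have k0 := spreading_rate_gt0 tau0 c0.
have k1 : spreading_rate tau c <= 1.
  apply: le_trans (spreading_rate_le tau0 c01) _.
  by rewrite expR_le1 oppr_le0 mulr_ge0// ltW.
have bands n : exists m' M', in_band tau y (n%:R * (3 * tau)) m' M' /\
    M' - m' = q ^+ n * (M - m).
  elim: n => [|n [m' [M' [band' w']]]].
    by exists m, M; rewrite mul0r expr0 mul1r.
  have t0 : 0 <= n%:R * (3 * tau) by rewrite !mulr_ge0// ltW.
  have [m2 [M2 [band2 w2]]] := band_contracts i0 tau0 adm c01 cpsi ysol t0 band'.
  exists m2, M2; split; first by rewrite -natr1 mulrDl mul1r.
  by rewrite w2 w' exprS mulrA.
have qcvg : q ^+ n * (M - m) @[n --> \oo] --> (0 : R).
  rewrite -[X in _ --> X](mul0r (M - m)); apply: cvgM; last exact: cvg_cst.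
  by apply: cvg_expr; rewrite ger0_norm /q; lra.
have [n _ /(_ n (leqnn n))/= qn] := cvgr_le _ qcvg _ e0.
have [m' [M' [band' w']]] := bands n.
have t0 : 0 <= n%:R * (3 * tau) by rewrite !mulr_ge0// ltW.
near=> t.
have tn : n%:R * (3 * tau) - tau <= t by near: t; exact: (nbhs_pinfty_ge (num_real _)).
move=> i j; have fwd := in_band_forward tau0 adm ysol t0 band'.
have /andP[a1 a2] := fwd i t tn; have /andP[b1 b2] := fwd j t tn.
by rewrite ler_norml; apply/andP; split; lra.
Unshelve. all: by end_near. Qed.

Lemma initial_band (R : realType) (N : nat) (tau : R) (y : 'I_N -> R -> R) :
  0 < tau -> (forall i, {within `[- tau, 0], continuous (y i)}) ->
  exists B, in_band tau y 0 (- B) B.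
Proof.
move=> tau0 cy.
have : forall i, exists b, forall s, - tau <= s <= 0 -> `|y i s| <= b.
  move=> i.
  have cny : {within `[- tau, 0], continuous (fun s => `|y i s|)}.
    by move=> s; apply: continuous_comp; [exact: cy|exact: norm_continuous].
  have t0 : - tau <= 0 by rewrite oppr_le0 ltW.
  have [s _ smax] := EVT_max t0 cny.
  by exists `|y i s| => u ub; apply: smax; rewrite in_itv.
move=> /choice[b yb]; exists (\big[Num.max/0]_i b i) => i s.
rewrite sub0r => /(yb i) ybi; rewrite -ler_norml.
exact: le_trans ybi (le_bigmax _ _ _).
Qed.

(** * From coordinates to the Euclidean diameter *)

Lemma is_derive_coord (R : realType) (d : nat) (f : R -> 'rV[R]_d) (t : R)
    (df : 'rV[R]_d) (k : 'I_d) :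
  is_derive t 1 f df -> is_derive t 1 (fun s => f s ord0 k) (df ord0 k).
Proof.
move=> [cvgf limf].
have fcvg : h^-1 *: (f (h *: 1 + t) - f t) @[h --> 0^'] --> df.
  by rewrite -limf; exact: cvgf.
have : h^-1 *: (f (h *: 1 + t) ord0 k - f t ord0 k) @[h --> 0^'] --> df ord0 k.
  have := cvg_comp _ _ fcvg (@coord_continuous R 1 d ord0 k df).
  by apply: cvg_trans; apply: near_eq_cvg; near=> h; rewrite /= !mxE.
move=> cvgc; split; first exact: cvgP cvgc.
exact: cvg_lim cvgc.
Unshelve. all: by end_near. Qed.

Lemma scalar_solution_coord (R : realType) (N d : nat) (tau : R)
    (psi : 'I_N -> 'I_N -> R -> R) (x0 x : 'I_N -> R -> 'rV[R]_d) (k : 'I_d) :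
  is_solution tau psi x0 x ->
  scalar_solution tau psi (fun i t => x i t ord0 k).
Proof.
move=> sol; split=> [i|i t t0]; have [cx _ dx _] := sol i.
  move=> t; apply: (@continuous_comp _ _ _ (x i : subspace _ -> _)
    (fun v : 'rV[R]_d => v ord0 k)); first exact: cx.
  exact: coord_continuous.
apply: is_derive_eq (is_derive_coord k (dx t t0)) _.
by rewrite summxE; apply: eq_bigr => j _; rewrite !mxE.
Qed.

(** The factor [d] is not optimal ([Num.sqrt d%:R] is); it avoids a square root. *)
Lemma euclidean_norm_le (R : realType) (d : nat) (v : 'rV[R]_d) (b : R) :
  0 <= b -> (forall k, `|v ord0 k| <= b) -> euclidean_norm v <= d%:R * b.
Proof.
move=> b0 vb; have db : 0 <= d%:R * b by exact: mulr_ge0.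
rewrite /euclidean_norm -(ger0_norm db) -sqrtr_sqr ler_sqrt ?sqr_ge0//.
apply: (@le_trans _ _ (\sum_(k < d) b ^+ 2)).
  by apply: ler_sum => k _; rewrite -[leLHS]real_normK ?num_real// ler_pXn2r ?nnegrE.
rewrite sumr_const card_ord -[leLHS]mulr_natl exprMn ler_wpM2r ?sqr_ge0//.
by rewrite -natrX ler_nat; case: (d) => // n; rewrite expnS expn1 leq_pmulr.
Qed.

(** This bound comes from the maximum principle alone, hence before any positive
    lower bound on the weights is known: it provides the radius at which global
    positivity is used. *)
Lemma solution_distances_bounded (R : realType) (N d : nat) (tau : R)
    (psi : 'I_N -> 'I_N -> R -> R) (x0 x : 'I_N -> R -> 'rV[R]_d) :
  0 < tau -> admissible_weights psi -> is_solution tau psi x0 x ->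
  exists2 r, 0 < r &
    forall t i j, - tau <= t -> euclidean_norm (x i t - x j t) <= r.
Proof.
move=> tau0 adm sol.
have : forall k : 'I_d, exists B, forall i t, - tau <= t -> `|x i t ord0 k| <= B.
  move=> k; have ksol := scalar_solution_coord k sol.
  have [|B band] := @initial_band R N tau (fun i t => x i t ord0 k) tau0.
    by apply: (scalar_solution_continuous ksol).
  exists B => i t tt; rewrite ler_norml.
  by apply: (in_band_forward tau0 adm ksol (lexx 0) band); rewrite sub0r.
move=> /choice[B xB]; pose b := \big[Num.max/0]_k B k.
have b0 : 0 <= b by exact: bigmax_ge_id.
exists (d%:R * (2 * b) + 1).
  by rewrite ltr_wpDl// !mulr_ge0.
move=> t i j tt; apply: ler_wpDr => //.
apply: euclidean_norm_le => [|k]; first exact: mulr_ge0.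
have xb l : `|x l t ord0 k| <= b by exact: le_trans (xB k l t tt) (le_bigmax _ _ _).
rewrite !mxE; apply: le_trans (ler_normB _ _) _.
by have := xb i; have := xb j; lra.
Qed.

(** The constant given by global positivity depends on the radius but not on the
    time horizon, so it serves for all times at once. *)
Lemma weights_uniformly_positive (R : realType) (N d : nat) (tau : R)
    (psi : 'I_N -> 'I_N -> R -> R) (x0 x : 'I_N -> R -> 'rV[R]_d) :
  (2 <= N)%N -> 0 < tau -> admissible_weights psi ->
  is_solution tau psi x0 x -> global_positivity tau psi x ->
  exists2 c, 0 < c <= 1 & forall i j t, i != j -> 0 <= t -> c <= psi i j t.
Proof.
move=> N2 tau0 adm sol pos.
have [r r0 xr] := solution_distances_bounded tau0 adm sol.
have [c c0 cpsi] := pos r r0.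
have N1 : 0 < N.-1%:R :> R by rewrite ltr0n -subn1 subn_gt0.
exists (Num.min (c / N.-1%:R) 1).
  by rewrite lt_min divr_gt0// ltr01 ge_min lexx orbT.
move=> i j t ij t0; rewrite ge_min; apply/orP; left.
apply: (cpsi (t + 1)) => //; first by lra.
  by move=> s k l /andP[ts _]; exact: xr.
by lra.
Qed.

Theorem theorem1 (R : realType) (N d : nat) (tau : R)
    (psi : 'I_N -> 'I_N -> R -> R) (x0 x : 'I_N -> R -> 'rV[R]_d) :
  (2 <= N)%N -> (1 <= d)%N -> 0 < tau ->
  (forall i : 'I_N, {within `[- tau, 0], continuous (x0 i)}) ->
  (forall i j : 'I_N, i != j -> {within `[0, +oo[, continuous (psi i j)}) ->
  (forall (i j : 'I_N) (t : R), i != j -> 0 <= t -> 0 <= psi i j t) ->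
  (forall (i : 'I_N) (t : R), 0 <= t -> \sum_(j < N | j != i) psi i j t <= 1) ->
  is_solution tau psi x0 x ->
  global_positivity tau psi x ->
  diameter x t @[t --> +oo] --> (0 : R).
Proof.
move=> N2 d1 tau0 _ _ psi0 psi1 sol pos.
have adm : admissible_weights psi by split.
have [c c01 cpsi] := weights_uniformly_positive N2 tau0 adm sol pos.
have i0 : 'I_N by exact: Ordinal (ltnW N2).
have d0 : 0 < d%:R :> R by rewrite ltr0n.
apply/cvgrPdist_le => e e0.
have coords k : \forall t \near +oo, forall i j,
    `|x i t ord0 k - x j t ord0 k| <= e / d%:R.
  have ksol := scalar_solution_coord k sol.
  have [|B band] := @initial_band R N tau (fun i t => x i t ord0 k) tau0.
    by apply: (scalar_solution_continuous ksol).
  exact: (scalar_consensus i0 tau0 adm c01 cpsi ksol band (divr_gt0 e0 d0)).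
apply: filterS (filter_forall _ coords) => t xt.
have dx0 : 0 <= diameter x t by exact: bigmax_ge_id.
rewrite sub0r normrN ger0_norm//.
apply: bigmax_le => [|i _]; first exact: ltW.
apply: bigmax_le => [|j _]; first exact: ltW.
have -> : e = d%:R * (e / d%:R) by rewrite mulrC divfK// gt_eqF.
apply: euclidean_norm_le => [|k]; first exact/ltW/divr_gt0.
by rewrite !mxE; exact: xt.
Qed.
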